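(* Let $A_1,\dots,A_k$ be the matrices of a $k$-determinantal measure $\mu$ on $[k]^n$, and suppose that each $A_j$ is symmetric and that the $A_j$ commute with each other. Let $a_{ji}$ ($1\le j\le k$, $1\le i\le n$) be the eigenvalue of $A_j$ on the $i$th vector of a common eigenbasis of $A_1,\dots,A_k$. Then the characteristic polynomial of $\mu$ factors as $$P(x_1,\dots,x_k)=\prod_{i=1}^n\left(a_{1i}x_1+a_{2i}x_2+\dots+a_{ki}x_k\right),$$ and the measure $\rho$ on $\{0,1,2,\dots\}^k$ which counts the number of occurrences of each color is the distribution of a sum of $n$ independent $k$-sided die rolls, where the $i$th die is biased proportionally to $a_{1i},\dots,a_{ki}$; that is, $\rho$ is the law of $X_1+\dots+X_n$ where the $X_i$ are independent and $X_i$ equals the $j$th standard basis vector of $\mathbb{Z}^k$ with probability $a_{ji}$.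
   Context: $[k]=\{1,\dots,k\}$ is the set of colors. A $k$-determinantal measure on $[k]^n$ with matrices $A_1,\dots,A_k$ is a probability measure on $[k]^n$, where the $A_i$ are real $n\times n$ matrices with $A_1+\dots+A_k=I$, and for all $(i_1,\dots,i_n)\in[k]^n$, $\Pr((i_1,\dots,i_n))=\det(A_{i_1}^1,A_{i_2}^2,\dots,A_{i_n}^n)$, the determinant of the matrix whose $j$th column is the $j$th column of $A_{i_j}$. Its characteristic polynomial is $P(x_1,\dots,x_k)=\det(x_1A_1+\dots+x_kA_k)$. The measure $\rho$ on $\{0,1,2,\dots\}^k$ is the image of $\mu$ under the map sending a sequence in $[k]^n$ to the vector whose $j$th entry is the number of occurrences of color $j$. *)

(* Defs.v *)
From HB Require Import structures.
From mathcomp Require Import all_boot all_order all_algebra.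
From mathcomp Require Import all_classical all_reals all_analysis.
(* The notations of mpoly clash with those of the analysis library; 'X_j is
   therefore written mpolyX R (mnm1 j). *)
From mathcomp Require Import -(notations) mpoly.

Set Implicit Arguments.
Unset Strict Implicit.
Unset Printing Implicit Defensive.

Import Order.TTheory GRing.Theory Num.Theory.

Local Open Scope classical_set_scope.
Local Open Scope ring_scope.

(* T with the sigma-algebra of all its subsets. *)
Definition discrete (T : Type) : Type := T.

HB.instance Definition _ (T : pointedType) := Pointed.on (discrete T).
HB.instance Definition _ (T : pointedType) :=
  @isMeasurable.Build default_measure_display (discrete T)
    discrete_measurable discrete_measurable0
    discrete_measurableC discrete_measurableU.

(* Measurable types are inhabited, so the set of colors is 'I_k.+1: here and
   below there are k.+1 >= 1 colors, numbered from 0. *)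
Definition color_seq (n k : nat) : Type := {ffun 'I_n -> 'I_k.+1}.

HB.instance Definition _ (n k : nat) := Choice.on (color_seq n k).
HB.instance Definition _ (n k : nat) :=
  isPointed.Build (color_seq n k) [ffun=> ord0].

Definition determinantal (R : realType) (n k : nat)
    (mu : probability (discrete (color_seq n k)) R)
    (A : 'I_k.+1 -> 'M[R]_n) : Prop :=
  \sum_j A j = 1%:M /\
  forall s : color_seq n k,
    mu [set s] = (\det (\matrix_(r, c) A (s c) r c))%:E.

Definition det_charpoly (R : realType) (n k : nat)
    (A : 'I_k.+1 -> 'M[R]_n) : mpoly k.+1 R :=
  \det (\sum_j mpolyX R (mnm1 j) *: map_mx (@mpolyC k.+1 R) (A j)).

Definition color_count (n k : nat) (s : color_seq n k) : 'rV[nat]_k.+1 :=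
  \row_j #|[set i | s i == j]%SET|.

Definition count_measure (R : realType) (n k : nat)
    (mu : probability (discrete (color_seq n k)) R) :
    set (discrete 'rV[nat]_k.+1) -> \bar R :=
  pushforward mu
    (@color_count n k : discrete (color_seq n k) -> discrete 'rV[nat]_k.+1).

(* a j i is the eigenvalue of A j on the i-th vector of the basis v. *)
Definition common_eigenbasis (R : realType) (n k : nat)
    (A : 'I_k.+1 -> 'M[R]_n) (v : n.-tuple 'cV[R]_n)
    (a : 'I_k.+1 -> 'I_n -> R) : Prop :=
  basis_of fullv v /\
  forall j i, A j *m tnth v i = a j i *: tnth v i.

Definition mutually_independent (R : realType) d d' (T : measurableType d)
    (T' : measurableType d') (P : probability T R) (I : finType)
    (X : I -> {RV P >-> T'}) : Prop :=
  forall (J : {set I}) (B : I -> set T'),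
    (forall i, i \in J -> measurable (B i)) ->
    P (\bigcap_(i in [set` J]) (X i @^-1` B i)) =
      (\prod_(i in J) P (X i @^-1` B i))%E.

(* X i is the standard basis vector e_j with probability a j i, and the X i are
   independent. *)
Definition independent_dice (R : realType) (n k : nat)
    (a : 'I_k.+1 -> 'I_n -> R) d (T : measurableType d) (P : probability T R)
    (X : 'I_n -> {RV P >-> discrete 'rV[nat]_k.+1}) : Prop :=
  mutually_independent X /\
  forall i j, P (X i @^-1` [set delta_mx 0 j : 'rV[nat]_k.+1]) = (a j i)%:E.

(* Main.v *)
(** A real symmetric matrix is diagonalizable over the complex numbers with real
    eigenvalues, so its minimal polynomial already splits over the reals with
    simple roots; commuting diagonalizable matrices have a common eigenbasis.
    Conjugating by the eigenbasis turns x_1 A_1 + ... + x_k A_k into a diagonal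
    matrix, which gives the factorization of the characteristic polynomial.
    Expanding the determinant by multilinearity in the columns gives
    P = \sum_s mu(s) \prod_i x_(s i), so P is the generating polynomial of the
    color counts under mu. Expanding the product of linear forms gives the
    generating polynomial of the sum of the dice; equal polynomials have equal
    coefficients. That the a_ji are probabilities follows from
    A_1 + ... + A_k = I and from the positivity of P on the positive orthant. *)

Require Import Defs.
From HB Require Import structures.
From mathcomp Require Import all_boot all_order all_algebra.
From mathcomp Require Import perm.
From mathcomp Require Import lra.
From mathcomp Require Import all_classical all_reals all_analysis.
From mathcomp Require Import -(notations) mpoly.
From mathcomp Require Import -(notations) complex.

Set Implicit Arguments.
Unset Strict Implicit.
Unset Printing Implicit Defensive.

Import Order.TTheory GRing.Theory Num.Theory.

Local Open Scope classical_set_scope.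
Local Open Scope ring_scope.

(** * Simultaneous diagonalization of commuting symmetric matrices *)

(** Minimal polynomials are preserved by conjugation and by field extension, so [A] has that of
    [diag_mx d], a product of distinct linear factors over [F]. *)
Lemma diagonalizable_map (F K : fieldType) (f : {rmorphism F -> K}) (n : nat)
    (A : 'M[F]_n) (P : 'M[K]_n) (d : 'rV[F]_n) :
  P \in unitmx -> map_mx f A = invmx P *m diag_mx (map_mx f d) *m P ->
  diagonalizable A.
Proof.
case: n A P d => [|n] A P d Punit fA.
  by exists 1%:M; rewrite ?unitmx1// /similar_to; apply/is_diag_mxP => -[].
apply/diagonalizableP; exists (undup [seq d 0 i | i <- enum 'I_n.+1]).
  exact: undup_uniq.
have minpolyE : mxminpoly (map_mx f A) = mxminpoly (map_mx f (diag_mx d)).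
  rewrite map_diag_mx fA -(conjVmx _ Punit).
  by apply: mxminpoly_uconj; rewrite unitmx_inv.
rewrite -mxminpoly_diag -(dvdp_map f) -[X in X %| _]mxminpoly_map minpolyE.
by rewrite mxminpoly_map dvdpp.
Qed.

Lemma symmetric_diagonalizable (R : rcfType) (n : nat) (A : 'M[R]_n) :
  A^T = A -> diagonalizable A.
Proof.
move=> symA; pose f : {rmorphism R -> complex R} := real_complex R.
have realA : map_mx f A \is a realmx.
  by apply/mxOverP => i j; rewrite mxE; apply/complex_realP; exists (A i j).
have hermA : map_mx f A \is hermsymmx.
  apply: realsym_hermsym => //; apply/is_hermitianmxP.
  by rewrite expr0 scale1r map_mx_id // map_trmx symA.
have /orthomx_spectralP specA := hermitian_normalmx hermA.
have /mxOverP reald := hermitian_spectral_diag_real hermA.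
pose d := \row_i complex.Re (spectral_diag (map_mx f A) 0 i).
have fd : map_mx f d = spectral_diag (map_mx f A).
  by apply/rowP => i; rewrite !mxE; exact: RRe_real.
apply: (@diagonalizable_map _ _ f _ A (spectralmx (map_mx f A)) d).
  exact: spectral_unit.
by rewrite fd.
Qed.

Lemma commuting_symmetric_eigenbasis (R : realType) (n k : nat)
    (A : 'I_k.+1 -> 'M[R]_n) :
  (forall j, (A j)^T = A j) -> (forall j l, comm_mx (A j) (A l)) ->
  exists v a, common_eigenbasis A v a.
Proof.
move=> symA commA.
have [P Punit /allP/= diagP] : codiagonalizable [seq A j | j <- enum 'I_k.+1].
  apply/codiagonalizableP; split=> [_ _ /mapP[j _ ->] /mapP[l _ ->]|].
    exact: commA.
  by move=> _ /mapP[j _ ->]; exact: symmetric_diagonalizable.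
have /choice[d dP] j : exists d, P *m A j = diag_mx d *m P.
  have /diagP/similar_diagPex[d] : A j \in [seq A j | j <- enum 'I_k.+1].
    by apply: map_f; rewrite mem_enum.
  by move=> /(similarP Punit) ?; exists d.
(* From [P *m A j = diag_mx (d j) *m P], the columns of [invmx P] are eigenvectors. They span,
   because [x] combines them with the entries of [P *m x] as coefficients. *)
exists [tuple col i (invmx P) | i < n], (fun j i => d j 0 i); split.
  rewrite basisEdim size_tuple dimvf /dim /= muln1 leqnn andbT.
  apply/subvP => x _; rewrite -[x]mul1mx -(mulVmx Punit) -mulmxA.
  have -> : invmx P *m (P *m x) =
      \sum_i (P *m x) i 0 *: [tuple col i (invmx P) | i < n]`_i.
    apply/colP => r; rewrite !mxE summxE; apply: eq_bigr => i _.
    by rewrite -tnth_nth tnth_mktuple !mxE mulrC.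
  by apply: memv_suml => i _; apply/memvZ/memv_span/mem_nth; rewrite size_tuple.
move=> j i; rewrite tnth_mktuple !colE mulmxA.
have -> : A j *m invmx P = invmx P *m diag_mx (d j).
  by rewrite -[A j](mulKmx Punit) dP !mulmxA mulmxK.
rewrite -mulmxA scalemxAr; congr (_ *m _).
apply/colP => r; rewrite mul_diag_mx !mxE.
by case: eqVneq => [->|]; rewrite ?mulr0.
Qed.

(** * The determinant of a combination of the matrices, in two forms *)

Definition eigenbasis_mx (R : nmodType) (n : nat) (v : n.-tuple 'cV[R]_n) :
  'M[R]_n := \matrix_(r, c) tnth v c r 0.

(** The coordinates in [v] of the standard basis vectors form a right inverse. *)
Lemma eigenbasis_mx_unit (R : fieldType) (n : nat) (v : n.-tuple 'cV[R]_n) :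
  basis_of fullv v -> eigenbasis_mx v \in unitmx.
Proof.
move=> vB; pose C : 'M[R]_n := \matrix_(i, c) coord v i (delta_mx c 0).
suff /mulmx1_unit[] : eigenbasis_mx v *m C = 1%:M by [].
apply/matrixP => r c.
have /colP/(_ r) := coord_basis vB (memvf (delta_mx c 0)).
rewrite !mxE summxE eqxx andbT => ->.
by apply: eq_bigr => i _; rewrite !mxE (tnth_nth 0) mulrC.
Qed.

(** A general [f] covers both the polynomial identity and its evaluation at real points. *)
Lemma det_charpoly_eigen (R : realType) (n k : nat) (A : 'I_k.+1 -> 'M[R]_n)
    v a (S : comNzRingType) (f : {rmorphism R -> S}) (x : 'I_k.+1 -> S) :
  common_eigenbasis A v a ->
  \det (\sum_j x j *: map_mx f (A j)) = \prod_i \sum_j x j * f (a j i).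
Proof.
move=> [/eigenbasis_mx_unit Vunit vE]; pose V := eigenbasis_mx v.
have AV j : A j *m V = V *m diag_mx (\row_i a j i).
  apply/matrixP => r c; rewrite mul_mx_diag !mxE mulrC.
  have /colP/(_ r) := vE j c; rewrite !mxE => <-.
  by apply: eq_bigr => i _; rewrite !mxE.
(* [S] is only a commutative ring, so [\det V] is cancelled against the image of its inverse. *)
have detV : \det (map_mx f V) * \det (map_mx f (invmx V)) = 1.
  by rewrite -det_mulmx -map_mxM mulmxV// map_mx1 det1.
rewrite -[LHS]mul1r -detV mulrAC.
suff -> : \det (map_mx f V) * \det (\sum_j x j *: map_mx f (A j)) =
    \det (map_mx f V) * \prod_i \sum_j x j * f (a j i).
  by rewrite mulrAC detV mul1r.
rewrite mulrC -det_mulmx mulmx_suml.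
have -> : \sum_j x j *: map_mx f (A j) *m map_mx f V =
    map_mx f V *m diag_mx (\row_i \sum_j x j * f (a j i)).
  transitivity
      (\sum_j map_mx f V *m (x j *: map_mx f (diag_mx (\row_i a j i)))).
    by apply: eq_bigr => j _; rewrite -scalemxAl -scalemxAr -!map_mxM AV.
  rewrite -mulmx_sumr; congr (_ *m _); apply/matrixP => r c.
  rewrite summxE !mxE -sumrMnl; apply: eq_bigr => j _.
  by rewrite !mxE rmorphMn mulrnAr.
rewrite det_mulmx det_diag; congr (_ * _).
by apply: eq_bigr => i _; rewrite mxE.
Qed.

Definition color_det (R : comNzRingType) (n k : nat) (A : 'I_k.+1 -> 'M[R]_n)
    (s : {ffun 'I_n -> 'I_k.+1}) : R := \det (\matrix_(r, c) A (s c) r c).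

Lemma det_charpoly_expand (R S : comNzRingType) (n k : nat)
    (A : 'I_k.+1 -> 'M[R]_n) (f : {rmorphism R -> S}) (x : 'I_k.+1 -> S) :
  \det (\sum_j x j *: map_mx f (A j)) =
    \sum_(s : {ffun 'I_n -> 'I_k.+1}) (\prod_c x (s c)) * f (color_det A s).
Proof.
(* After transposing, each Leibniz product runs over the columns, and distributing it over the sums
   chooses one color per column. *)
rewrite -det_tr /determinant.
transitivity (\sum_(p : 'S_n) \sum_(s : {ffun 'I_n -> 'I_k.+1})
    (-1) ^+ p * \prod_c (x (s c) * f (A (s c) (p c) c))).
  apply: eq_bigr => p _; rewrite -mulr_sumr; congr (_ * _).
  rewrite -(bigA_distr_bigA (fun c j => x j * f (A j (p c) c))).
  apply: eq_bigr => c _; rewrite mxE summxE.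
  by apply: eq_bigr => j _; rewrite !mxE.
rewrite exchange_big; apply: eq_bigr => s _.
rewrite /color_det -det_tr rmorph_sum mulr_sumr; apply: eq_bigr => p _.
rewrite big_split rmorphM rmorph_sign mulrCA rmorph_prod; congr (_ * (_ * _)).
by apply: eq_bigr => c _; rewrite !mxE.
Qed.

(** * Color counts as exponents of monomials *)

Lemma mpolyX_count (R : comNzRingType) (n k : nat) (s : color_seq n k)
    (m : multinom k.+1) :
  mcoeff m (\prod_i mpolyX R (mnm1 (s i))) = (color_count s == \row_j m j)%:R.
Proof.
rewrite mprodXE mcoeffX; congr (nat_of_bool _)%:R.
have countE j : (\big[mnm_add/mnm0]_(i < n) mnm1 (s i)) j = color_count s 0 j.
  rewrite mnm_sumE mxE cardsE -sum1_card [RHS]big_mkcond.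
  by apply: eq_bigr => i _; rewrite mnm1E.
apply/idP/idP => [/eqP<-|/eqP/rowP eqm].
  by apply/eqP/rowP => j; rewrite [RHS]mxE countE.
by apply/eqP/mnmP => j; rewrite countE eqm mxE.
Qed.

(* The monomial of the color sequence s records exactly color_count s, so the
   generating polynomial of a weight determines its image under color_count. *)
Lemma count_genpoly_inj (R : comNzRingType) (n k : nat)
    (w w' : color_seq n k -> R) :
  \sum_(s : {ffun 'I_n -> 'I_k.+1}) w s *: \prod_i mpolyX R (mnm1 (s i)) =
  \sum_(s : {ffun 'I_n -> 'I_k.+1}) w' s *: \prod_i mpolyX R (mnm1 (s i)) ->
  forall B : pred 'rV[nat]_k.+1,
    \sum_(s : {ffun 'I_n -> 'I_k.+1} | B (color_count s)) w s =
    \sum_(s : {ffun 'I_n -> 'I_k.+1} | B (color_count s)) w' s.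
Proof.
move=> genE B.
have fiber (c : 'rV[nat]_k.+1) :
    \sum_(s : {ffun 'I_n -> 'I_k.+1} | color_count s == c) w s =
    \sum_(s : {ffun 'I_n -> 'I_k.+1} | color_count s == c) w' s.
  pose m := Multinom [tuple c 0 j | j < k.+1].
  have /(congr1 (mcoeff m)) := genE.
  have cE : \row_j m j = c.
    by apply/rowP => j; rewrite mxE mnmE.
  rewrite !raddf_sum /= => eqc; rewrite [LHS]big_mkcond [RHS]big_mkcond /=.
  have coefE (u : color_seq n k -> R) (s : {ffun 'I_n -> 'I_k.+1}) :
      mcoeff m (u s *: \prod_i mpolyX R (mnm1 (s i))) =
      if color_count s == c then u s else 0.
    by rewrite mcoeffZ mpolyX_count cE; case: ifP; rewrite ?mulr1 ?mulr0.
  by move: eqc; under eq_bigr do rewrite coefE;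
     under [in RHS]eq_bigr do rewrite coefE.
(* Partitioning a sum needs a finite type of classes; counts are at most [n], so they are encoded in
   ['I_n.+1] without loss. *)
pose cnt (s : {ffun 'I_n -> 'I_k.+1}) :=
  [ffun j => inord (color_count s 0 j) : 'I_n.+1].
have cntK s (j : 'I_k.+1) : cnt s j = color_count s 0 j :> nat.
  by rewrite ffunE inordK// mxE ltnS (leq_trans (max_card _))// card_ord.
have cntP s t : (cnt s == cnt t) = (color_count s == color_count t).
  apply/eqP/eqP => [eqc|eqc]; last by rewrite /cnt eqc.
  by apply/rowP => j; rewrite -!cntK eqc.
rewrite (partition_big cnt xpredT)//= [RHS](partition_big cnt xpredT)//=.
apply: eq_bigr => c _.
case: (pickP (fun s => B (color_count s) && (cnt s == c))) =>
  [t /andP[Bt /eqP <-]|none].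
  have E s : B (color_count s) && (cnt s == cnt t) =
      (color_count s == color_count t).
    by rewrite cntP; case: eqP => [->|]; rewrite ?Bt ?andbF.
  by rewrite !(eq_bigl _ _ E) fiber.
by rewrite !big_pred0.
Qed.

(** * Probabilities carried by finitely many atoms *)

Lemma measure_finite_atoms_le d (T : measurableType d) (R : realType)
    (mu : {measure set T -> \bar R}) (I : finType) (E : I -> set T)
    (p : I -> R) (D : set T) (Q : pred I) :
  (forall i, measurable (E i)) -> trivIset setT E ->
  (forall i, mu (E i) = (p i)%:E) ->
  measurable D -> (forall i, Q i -> E i `<=` D) ->
  ((\sum_(i | Q i) p i)%:E <= mu D)%E.
Proof.
move=> mE tE muE mD QD.
pose r := [seq i <- enum I | Q i].
have r_uniq : uniq r by rewrite filter_uniq ?enum_uniq.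
have -> : (\sum_(i | Q i) p i)%:E = mu (\bigcup_(i in [set` r]) E i).
  rewrite measure_fin_bigcup//.
  - rewrite -fsbig_seq// /r big_filter big_enum_cond /= -sumEFin.
    by apply: eq_big => i; rewrite ?andbT.
  - exact: sub_trivIset tE.
apply: le_measure; rewrite ?inE//.
  by apply: fin_bigcup_measurable.
apply: bigcup_sub => i /=; rewrite mem_filter => /andP[Qi _]; exact: QD.
Qed.

(* Bounding both D and its complement from below by the atoms they contain
   forces equality, since the atoms carry the whole mass. *)
Lemma probability_finite_atoms d (T : measurableType d) (R : realType)
    (P : probability T R) (I : finType) (E : I -> set T) (p : I -> R)
    (D : set T) (Q : pred I) :
  (forall i, measurable (E i)) -> trivIset setT E ->
  (forall i, P (E i) = (p i)%:E) -> \sum_i p i = 1 ->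
  measurable D -> (forall i, Q i -> E i `<=` D) ->
  (forall i, ~~ Q i -> E i `<=` ~` D) ->
  P D = (\sum_(i | Q i) p i)%:E.
Proof.
move=> mE tE PE p1 mD QD QnD.
have leD : (_ <= P D)%E := measure_finite_atoms_le mE tE PE mD QD.
have leDc : (_ <= P (~` D))%E :=
  measure_finite_atoms_le mE tE PE (measurableC mD) QnD.
have PDfin : P D \is a fin_num by exact: fin_num_measure.
move: leD leDc; rewrite probability_setC// -(fineK PDfin) -EFinB !lee_fin.
move: p1; rewrite (bigID Q) /= => <- leD leDc; congr EFin.
by apply/le_anti; rewrite leD andbT; lra.
Qed.

(** * Construction of independent dice *)

Lemma finite_probability_exists (R : realType) (n k : nat)
    (p : color_seq n k -> R) :
  (forall s, 0 <= p s) -> \sum_(s : {ffun 'I_n -> 'I_k.+1}) p s = 1 ->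
  exists P : probability (discrete (color_seq n k)) R, forall D,
    P D = (\sum_(s : {ffun 'I_n -> 'I_k.+1}) p s * (s \in D)%:R)%:E.
Proof.
move=> p_ge0 p1.
pose e := enum {ffun 'I_n -> 'I_k.+1}.
pose s0 : {ffun 'I_n -> 'I_k.+1} := [ffun=> ord0].
pose s_ i : discrete (color_seq n k) := nth s0 e i.
pose m : {measure set (discrete (color_seq n k)) -> \bar R} :=
  msum (fun i => mscale (NngNum (p_ge0 (s_ i))) (dirac (s_ i))) (size e).
have mE D : m D = (\sum_(s : {ffun 'I_n -> 'I_k.+1}) p s * (s \in D)%:R)%:E.
  rewrite -sumEFin -[RHS]big_enum (big_nth s0) big_mkord /m /msum /=.
  by apply: eq_bigr => i _; rewrite EFinM.
have m1 : m setT = 1%E.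
  rewrite mE; congr EFin; rewrite -[RHS]p1.
  by apply: eq_bigr => s _; rewrite in_setT mulr1.
(* As [m] has mass 1, normalizing keeps its values and supplies the probability structure; the Dirac
   mass is the fallback for zero or infinite mass. *)
exists (mnormalize m \d_(s_ 0%N)) => D.
by rewrite /= /mnormalize m1 onee_eq0 /= invr1 mule1 mE.
Qed.

Definition die_roll (n k : nat) (i : 'I_n) (s : discrete (color_seq n k)) :
  discrete 'rV[nat]_k.+1 := delta_mx 0 (s i).

HB.instance Definition _ n k (i : 'I_n) :=
  @isMeasurableFun.Build _ _ (discrete (color_seq n k))
    (discrete 'rV[nat]_k.+1) (@die_roll n k i) (fun _ _ _ => I).

(** The dice are the coordinates of a color sequence drawn with the product weight
    [\prod_i a (s i) i]. *)
Lemma independent_dice_exist (R : realType) (n k : nat)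
    (a : 'I_k.+1 -> 'I_n -> R) :
  (forall i j, 0 <= a j i) -> (forall i, \sum_j a j i = 1) ->
  exists (d : measure_display) (T : measurableType d) (P : probability T R)
    (X : 'I_n -> {RV P >-> discrete 'rV[nat]_k.+1}), independent_dice a X.
Proof.
move=> a_ge0 a1.
have [||P PE] := @finite_probability_exists R n k (fun s => \prod_i a (s i) i).
- by move=> s; apply: prodr_ge0 => i _; exact: a_ge0.
- rewrite -(bigA_distr_bigA (fun i j => a j i)) big1// => i _; exact: a1.
pose X i : {RV P >-> discrete 'rV[nat]_k.+1} := @die_roll n k i.
exists _, _, P, X.
pose q (i : 'I_n) (B : set 'rV[nat]_k.+1) :=
  \sum_j a j i * (delta_mx 0 j \in B)%:R.
have PX (J : {set 'I_n}) (B : 'I_n -> set 'rV[nat]_k.+1) :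
    P (\bigcap_(i in [set` J]) (X i @^-1` B i)) = (\prod_(i in J) q i (B i))%:E.
  rewrite PE; congr EFin.
  (* Dice outside [J] get the weight 1, so their factors sum to 1 and the product over all dice
     reduces to [J]. *)
  pose b i j : R := if i \in J then (delta_mx 0 j \in B i)%:R else 1.
  transitivity (\prod_i \sum_j a j i * b i j); last first.
    rewrite [RHS]big_mkcond; apply: eq_bigr => i _.
    rewrite /b /q; case: (i \in J) => //.
    by under eq_bigr do rewrite mulr1; exact: a1.
  rewrite bigA_distr_bigA; apply: eq_bigr => s _; rewrite big_split /=.
  congr (_ * _); rewrite -big_mkcond /=.
  case: (boolP (s \in _)) => [/set_mem sJ|sJ].
    by rewrite big1// => i iJ; rewrite mem_set//; exact: sJ.
  apply/esym/eqP; rewrite prodf_seq_eq0; apply: contraNT sJ => /hasPn allB.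
  apply/mem_set => i /= iJ; apply/set_mem.
  have := allB i (mem_index_enum i).
  by rewrite iJ /=; case: (_ \in B i) => //; rewrite eqxx.
have PX1 i B : P (X i @^-1` B) = (q i B)%:E.
  have := PX [set i]%SET (fun=> B); rewrite big_set1 => <-; congr (P _).
  rewrite (_ : [set` _] = [set i]) ?bigcap_set1//.
  by apply/seteqP; split=> l /=; rewrite inE => /eqP.
split=> [J B _|i j].
  by rewrite PX -prodEFin; apply: eq_bigr => i _; rewrite PX1.
rewrite PX1 /q (bigD1 j) //= mem_set// mulr1 big1 ?addr0// => l lj.
rewrite (_ : _ \in _ = false) ?mulr0//.
apply/negbTE/negP => /set_mem /= /rowP/(_ l).
by rewrite !mxE !eqxx (negbTE lj).
Qed.

(** * Eigenvalues of a determinantal measure as probabilities *)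

Section DeterminantalColorLaw.
Variables (R : realType) (n k : nat).
Variables (mu : probability (discrete (color_seq n k)) R).
Variables (A : 'I_k.+1 -> 'M[R]_n) (detA : determinantal mu A).
Variables (v : n.-tuple 'cV[R]_n) (a : 'I_k.+1 -> 'I_n -> R).
Hypothesis eigA : common_eigenbasis A v a.

Lemma color_det_ge0 s : 0 <= color_det A s.
Proof. by rewrite -lee_fin -detA.2. Qed.

(** The matrices sum to the identity; apply this to the nonzero vector [tnth v i]. *)
Lemma eigenvalue_sum1 i : \sum_j a j i = 1.
Proof.
have [vB vE] := eigA.
have v_neq0 : tnth v i != 0 := free_not0 (basis_free vB) (mem_tnth i v).
apply/eqP; rewrite -subr_eq0.
have /eqP : (\sum_j a j i - 1) *: tnth v i = 0.
  rewrite scalerBl scale1r scaler_suml.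
  under eq_bigr do rewrite -vE.
  by rewrite -mulmx_suml detA.1 mul1mx subrr.
by rewrite scaler_eq0 (negbTE v_neq0) orbF.
Qed.

(** Both sides evaluate the characteristic polynomial at [x]: by column expansion and by
    eigenvalues. *)
Lemma weighted_color_det x :
  \sum_(s : {ffun 'I_n -> 'I_k.+1}) (\prod_c x (s c)) * color_det A s =
  \prod_i \sum_j x j * a j i.
Proof.
have := det_charpoly_eigen idfun x eigA.
by rewrite (det_charpoly_expand _ idfun).
Qed.

Lemma color_det_sum1 : \sum_(s : {ffun 'I_n -> 'I_k.+1}) color_det A s = 1.
Proof.
have := weighted_color_det (fun=> 1).
rewrite (eq_bigr (color_det A)) => [->|s _]; last by rewrite big1 ?mul1r.
by apply: big1 => i _; under eq_bigr do rewrite mul1r; exact: eigenvalue_sum1.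
Qed.

(* At the positive point with coordinate 1 - 1/a at j and 1 elsewhere, a
   negative eigenvalue a of A_j would annihilate the characteristic polynomial,
   whose coefficients are nonnegative and sum to 1. *)
Lemma eigenvalue_ge0 i j : 0 <= a j i.
Proof.
rewrite leNgt; apply/negP => a_lt0.
pose x l := if l == j then 1 - (a j i)^-1 else 1.
have x_gt0 l : 0 < x l.
  rewrite /x; case: eqP => // _.
  by rewrite subr_gt0 (lt_trans _ ltr01)// invr_lt0.
have prod_gt0 (s : {ffun 'I_n -> 'I_k.+1}) : 0 < \prod_c x (s c).
  by apply: prodr_gt0 => c _.
have : \sum_(s : {ffun 'I_n -> 'I_k.+1}) (\prod_c x (s c)) * color_det A s = 0.
  rewrite weighted_color_det; apply/eqP/prodf_eq0; exists i => //; apply/eqP.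
  have := eigenvalue_sum1 i; rewrite (bigD1 j)//= => a1.
  rewrite (bigD1 j)//= /x eqxx.
  under eq_bigr => l /negbTE lj do rewrite lj mul1r.
  by rewrite mulrBl mul1r mulVf ?lt_eqF// addrAC a1 subrr.
move=> /psumr_eq0P sum0.
have det0 s : color_det A s = 0.
  have /eqP : (\prod_c x (s c)) * color_det A s = 0.
    by apply: sum0 => // t _; rewrite mulr_ge0 ?color_det_ge0// ltW.
  by rewrite mulf_eq0 gt_eqF//= => /eqP.
by have /eqP := color_det_sum1; rewrite big1// eq_sym oner_eq0.
Qed.

Lemma det_charpoly_factor :
  det_charpoly A = \prod_i \sum_j a j i *: mpolyX R (mnm1 j).
Proof.
rewrite /det_charpoly (det_charpoly_eigen _ _ eigA).
by apply: eq_bigr => i _; apply: eq_bigr => j _; rewrite mulrC mul_mpolyC.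
Qed.

(** * Laws of the color counts and of the sum of the dice *)

(** The two weights may differ on single sequences; they agree once grouped by count, since both
    have generating polynomial [det_charpoly A]. *)
Lemma color_count_weights (B : pred 'rV[nat]_k.+1) :
  \sum_(s : {ffun 'I_n -> 'I_k.+1} | B (color_count s)) color_det A s =
  \sum_(s : {ffun 'I_n -> 'I_k.+1} | B (color_count s)) \prod_i a (s i) i.
Proof.
apply: (@count_genpoly_inj R n k (color_det A) (fun s => \prod_i a (s i) i)).
transitivity (det_charpoly A).
  rewrite /det_charpoly det_charpoly_expand.
  by apply: eq_bigr => s _; rewrite mulrC mul_mpolyC.
rewrite det_charpoly_factor bigA_distr_bigA; apply: eq_bigr => s _.
by rewrite scaler_prod.
Qed.

Lemma count_measure_weights (B : set 'rV[nat]_k.+1) :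
  count_measure mu B =
  (\sum_(s : {ffun 'I_n -> 'I_k.+1} | `[< B (color_count s) >])
     \prod_i a (s i) i)%:E.
Proof.
rewrite -(color_count_weights (fun c => `[< B c >])).
apply: (@probability_finite_atoms _ _ R mu {ffun 'I_n -> 'I_k.+1}
  (fun s => [set s])).
- by [].
- by apply/trivIsetP => s t _ _ /eqP st; apply/seteqP; split=> // _ [-> /st].
- by move=> s; rewrite detA.2.
- exact: color_det_sum1.
- by [].
- by move=> s /asboolP Bs _ ->.
- by move=> s /asboolPn Bs _ ->.
Qed.

Lemma sum_delta_color_count (s : color_seq n k) :
  \sum_i (delta_mx 0 (s i) : 'rV[nat]_k.+1) = color_count s.
Proof.
apply/rowP => j; rewrite summxE mxE cardsE -sum1_card [RHS]big_mkcond.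
apply: eq_bigr => i _; rewrite mxE eqxx eq_sym -[RHS]/(nat_of_bool (s i == j)).
by case: (s i == j).
Qed.

(** The events prescribing a face for every die are disjoint and have total mass 1, so values other
    than basis vectors occur with probability 0. *)
Lemma dice_sum_weights d (T : measurableType d) (P : probability T R)
    (X : 'I_n -> {RV P >-> discrete 'rV[nat]_k.+1}) (B : set 'rV[nat]_k.+1) :
  independent_dice a X ->
  P [set w | B (\sum_i (X i w : 'rV[nat]_k.+1))] =
  (\sum_(s : {ffun 'I_n -> 'I_k.+1} | `[< B (color_count s) >])
     \prod_i a (s i) i)%:E.
Proof.
move=> [indX PX].
(* Here [f] ranges over all tuples of values, not only faces: the event on the sum is then a
   countable union of sets [E f], hence measurable. *)
pose E (f : {ffun 'I_n -> 'rV[nat]_k.+1}) := \bigcap_i (X i @^-1` [set f i]).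
have mE f : measurable (E f).
  by apply: fin_bigcap_measurable => // i _; exact: measurable_funPTI.
pose delta (s : {ffun 'I_n -> 'I_k.+1}) : {ffun 'I_n -> 'rV[nat]_k.+1} :=
  [ffun i => delta_mx 0 (s i)].
have E_sum f w : E f w -> \sum_i (X i w : 'rV[nat]_k.+1) = \sum_i f i.
  by move=> Ew; apply: eq_bigr => i _; exact: Ew.
have delta_sum s : \sum_i delta s i = color_count s.
  by rewrite -sum_delta_color_count; apply: eq_bigr => i _; rewrite ffunE.
apply: (@probability_finite_atoms _ _ R P {ffun 'I_n -> 'I_k.+1} (E \o delta)).
- by move=> s; exact: mE.
- apply/trivIsetP => s t _ _; apply: contra_neqP => /eqP/set0P[w [/= Es Et]].
  apply/ffunP => i; have := Es i I.
  rewrite /= (Et i I) !ffunE => /rowP/(_ (s i)).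
  by rewrite !mxE !eqxx eq_sym; case: eqP.
- move=> s; have := indX [set: 'I_n]%SET (fun i => [set delta s i]).
  rewrite (_ : [set` _] = setT); last first.
    by apply/seteqP; split=> i //= _; rewrite inE.
  move=> ->//; rewrite -prodEFin.
  apply: eq_big => [i|i _]; first by rewrite inE.
  by rewrite ffunE PX.
- rewrite -(bigA_distr_bigA (fun i j => a j i)) big1// => i _.
  exact: eigenvalue_sum1.
- pose BS := [set f : {ffun 'I_n -> 'rV[nat]_k.+1} | B (\sum_i f i)].
  rewrite (_ : [set w | _] = \bigcup_(f in BS) E f).
    rewrite bigcup_mkcond; apply: countable_bigcupT_measurable => [|f].
      exact: countableP.
    by case: ifP.
  apply/seteqP; split=> [w Bw|w [f Bf Ew]] /=; last by rewrite (E_sum _ _ Ew).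
  exists [ffun i => X i w] => [/=|i _ /=]; last by rewrite ffunE.
  by rewrite /BS /=; under eq_bigr do rewrite ffunE.
- by move=> s /asboolP Bs w /E_sum Ew /=; rewrite Ew delta_sum.
- by move=> s /asboolPn Bs w /E_sum Ew /=; rewrite Ew delta_sum.
Qed.

End DeterminantalColorLaw.

Theorem mainTheorem7 (R : realType) (n k : nat)
    (mu : probability (discrete (color_seq n k)) R)
    (A : 'I_k.+1 -> 'M[R]_n)
    (detA : determinantal mu A)
    (symA : forall j, (A j)^T = A j)
    (commA : forall j l, comm_mx (A j) (A l)) :
  (exists v a, common_eigenbasis A v a) /\
  forall (v : n.-tuple 'cV[R]_n) (a : 'I_k.+1 -> 'I_n -> R),
    common_eigenbasis A v a ->
    [/\ det_charpoly A = \prod_i \sum_j a j i *: mpolyX R (mnm1 j),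
        (forall i j, 0 <= a j i) /\ (forall i, \sum_j a j i = 1),
        (exists (d : measure_display) (T : measurableType d)
            (P : probability T R)
            (X : 'I_n -> {RV P >-> discrete 'rV[nat]_k.+1}),
          independent_dice a X)
      & forall (d : measure_display) (T : measurableType d)
            (P : probability T R)
            (X : 'I_n -> {RV P >-> discrete 'rV[nat]_k.+1}),
          independent_dice a X ->
          forall B : set 'rV[nat]_k.+1,
            count_measure mu B = P [set w | B (\sum_i (X i w : 'rV[nat]_k.+1))]].
Proof.
split; first exact: commuting_symmetric_eigenbasis.
move=> v a eigA; split.
- exact: (det_charpoly_factor eigA).
- split; [exact: (eigenvalue_ge0 detA eigA)|exact: (eigenvalue_sum1 detA eigA)].
- apply: independent_dice_exist.
    exact: (eigenvalue_ge0 detA eigA).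
  exact: (eigenvalue_sum1 detA eigA).
- move=> d T P X diceX B.
  rewrite (count_measure_weights detA eigA).
  by rewrite (dice_sum_weights detA eigA _ diceX).
Qed.
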